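(* Let $\mathcal C$ be a semi-abelian category. The following are equivalent: (i) $\mathcal C$ is arithmetical; (ii) the category of internal groupoids in $\mathcal C$ is equivalent to the category of internal reflexive relations in $\mathcal C$ (i.e. every internal groupoid in $\mathcal C$ has jointly monomorphic domain and codomain); (iii) the only abelian object of $\mathcal C$ is the zero object.
   Context: Semi-abelian category: pointed, Barr-exact, protomodular, with binary coproducts. $\mathcal C$ is arithmetical if for every object $X$ the lattice of (internal) equivalence relations on $X$ is distributive. An object $A$ is abelian if there is $\varphi\colon A\times A\to A$ with $\varphi\circ(1_A,0)=1_A=\varphi\circ(0,1_A)$. A reflexive relation is a reflexive graph $d,c\colon C_1\rightrightarrows C_0$ (common section $e$) with $(d,c)$ jointly monomorphic. *)

(* Defs.v *)
Set Implicit Arguments.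
Unset Strict Implicit.

Record Cat := MkCat {
  Ob :> Type;
  Hom : Ob -> Ob -> Type;
  idm : forall A, Hom A A;
  comp : forall A B C, Hom B C -> Hom A B -> Hom A C;
  comp_assoc : forall A B C D (h : Hom C D) (g : Hom B C) (f : Hom A B),
      comp h (comp g f) = comp (comp h g) f;
  comp_id_l : forall A B (f : Hom A B), comp (idm B) f = f;
  comp_id_r : forall A B (f : Hom A B), comp f (idm A) = f
}.
Arguments Hom {c} _ _.
Arguments idm {c} A.
Arguments comp {c A B C} _ _.
Notation "g \o f" := (comp g f) (at level 40, left associativity).

Section Notions.
Variable C : Cat.

Definition is_terminal (T : C) : Prop :=
  forall X : C, exists f : Hom X T, forall g : Hom X T, g = f.
Definition is_initial (I : C) : Prop :=
  forall X : C, exists f : Hom I X, forall g : Hom I X, g = f.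
Definition is_zero_obj (Z : C) : Prop := is_initial Z /\ is_terminal Z.
Definition pointed : Prop := exists Z : C, is_zero_obj Z.

Definition is_zero_map (X Y : C) (f : Hom X Y) : Prop :=
  exists (Z : C) (a : Hom X Z) (b : Hom Z Y), is_zero_obj Z /\ f = b \o a.

Definition is_iso (X Y : C) (f : Hom X Y) : Prop :=
  exists g : Hom Y X, g \o f = idm X /\ f \o g = idm Y.

Definition jointly_monic (R X Y : C) (d : Hom R X) (c : Hom R Y) : Prop :=
  forall (T : C) (u v : Hom T R), d \o u = d \o v -> c \o u = c \o v -> u = v.

Definition is_pullback (X Y Z P : C) (f : Hom X Z) (g : Hom Y Z)
    (p1 : Hom P X) (p2 : Hom P Y) : Prop :=
  f \o p1 = g \o p2 /\
  forall (T : C) (a : Hom T X) (b : Hom T Y), f \o a = g \o b ->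
    exists h : Hom T P, p1 \o h = a /\ p2 \o h = b /\
      forall h' : Hom T P, p1 \o h' = a -> p2 \o h' = b -> h' = h.

Definition is_product (A B P : C) (p1 : Hom P A) (p2 : Hom P B) : Prop :=
  forall (T : C) (a : Hom T A) (b : Hom T B),
    exists h : Hom T P, p1 \o h = a /\ p2 \o h = b /\
      forall h' : Hom T P, p1 \o h' = a -> p2 \o h' = b -> h' = h.

Definition is_coproduct (A B S : C) (i1 : Hom A S) (i2 : Hom B S) : Prop :=
  forall (T : C) (a : Hom A T) (b : Hom B T),
    exists h : Hom S T, h \o i1 = a /\ h \o i2 = b /\
      forall h' : Hom S T, h' \o i1 = a -> h' \o i2 = b -> h' = h.

Definition is_coequalizer (R X Q : C) (f g : Hom R X) (q : Hom X Q) : Prop :=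
  q \o f = q \o g /\
  forall (T : C) (a : Hom X T), a \o f = a \o g ->
    exists h : Hom Q T, h \o q = a /\ forall h' : Hom Q T, h' \o q = a -> h' = h.

Definition regular_epi (X Q : C) (q : Hom X Q) : Prop :=
  exists (R : C) (f g : Hom R X), is_coequalizer f g q.

Definition is_kernel (K A B : C) (k : Hom K A) (p : Hom A B) : Prop :=
  is_zero_map (p \o k) /\
  forall (T : C) (a : Hom T A), is_zero_map (p \o a) ->
    exists b : Hom T K, k \o b = a /\ forall b' : Hom T K, k \o b' = a -> b' = b.

Definition has_terminal : Prop := exists T : C, is_terminal T.
Definition has_pullbacks : Prop :=
  forall (X Y Z : C) (f : Hom X Z) (g : Hom Y Z),
    exists (P : C) (p1 : Hom P X) (p2 : Hom P Y), is_pullback f g p1 p2.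
Definition finitely_complete : Prop := has_terminal /\ has_pullbacks.
Definition has_binary_coproducts : Prop :=
  forall A B : C, exists (S : C) (i1 : Hom A S) (i2 : Hom B S), is_coproduct i1 i2.

Definition kernel_pairs_have_coequalizers : Prop :=
  forall (X Y P : C) (f : Hom X Y) (p1 p2 : Hom P X), is_pullback f f p1 p2 ->
    exists (Q : C) (q : Hom X Q), is_coequalizer p1 p2 q.

Definition regular_epis_pullback_stable : Prop :=
  forall (X Y Z P : C) (q : Hom X Y) (g : Hom Z Y) (p1 : Hom P X) (p2 : Hom P Z),
    regular_epi q -> is_pullback q g p1 p2 -> regular_epi p2.

Definition regular_cat : Prop :=
  finitely_complete /\ kernel_pairs_have_coequalizers /\ regular_epis_pullback_stable.

Definition reflexive_rel (R X : C) (d c : Hom R X) : Prop :=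
  exists e : Hom X R, d \o e = idm X /\ c \o e = idm X.
Definition symmetric_rel (R X : C) (d c : Hom R X) : Prop :=
  exists s : Hom R R, d \o s = c /\ c \o s = d.
Definition transitive_rel (R X : C) (d c : Hom R X) : Prop :=
  forall (T : C) (u v : Hom T R), c \o u = d \o v ->
    exists w : Hom T R, d \o w = d \o u /\ c \o w = c \o v.
Definition is_equiv_rel (R X : C) (d c : Hom R X) : Prop :=
  jointly_monic d c /\ reflexive_rel d c /\ symmetric_rel d c /\ transitive_rel d c.

Definition effective_equiv_rels : Prop :=
  forall (R X : C) (d c : Hom R X), is_equiv_rel d c ->
    exists (Q : C) (q : Hom X Q), is_pullback q q d c.

Definition exact_cat : Prop := regular_cat /\ effective_equiv_rels.

(** ** Protomodularity (pointed, finitely complete case): split short five lemma *)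
Definition split_short_five_lemma : Prop :=
  forall (A B A' B' K K' : C)
    (p : Hom A B) (s : Hom B A) (p' : Hom A' B') (s' : Hom B' A')
    (k : Hom K A) (k' : Hom K' A')
    (f : Hom A A') (g : Hom B B') (h : Hom K K'),
    p \o s = idm B -> p' \o s' = idm B' ->
    is_kernel k p -> is_kernel k' p' ->
    p' \o f = g \o p -> f \o s = s' \o g -> f \o k = k' \o h ->
    is_iso g -> is_iso h -> is_iso f.

Definition protomodular : Prop := split_short_five_lemma.

Definition semi_abelian : Prop :=
  pointed /\ exact_cat /\ protomodular /\ has_binary_coproducts.

Record EqRel (X : C) := MkEqRel {
  er_ob : C;
  er_d : Hom er_ob X;
  er_c : Hom er_ob X;
  er_equiv : is_equiv_rel er_d er_c
}.

Definition er_le (X : C) (R S : EqRel X) : Prop :=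
  exists m : Hom (er_ob R) (er_ob S),
    er_d S \o m = er_d R /\ er_c S \o m = er_c R.

Definition is_meet (X : C) (M R S : EqRel X) : Prop :=
  er_le M R /\ er_le M S /\
  forall T : EqRel X, er_le T R -> er_le T S -> er_le T M.

Definition is_join (X : C) (J R S : EqRel X) : Prop :=
  er_le R J /\ er_le S J /\
  forall T : EqRel X, er_le R T -> er_le S T -> er_le J T.

(** distributivity: R /\ (S \/ T) <= (R /\ S) \/ (R /\ T)
    (the reverse inequality holds in any lattice) *)
Definition distributive_eqrels (X : C) : Prop :=
  forall (R S T J M M1 M2 J' : EqRel X),
    is_join J S T -> is_meet M R J ->
    is_meet M1 R S -> is_meet M2 R T -> is_join J' M1 M2 ->
    er_le M J'.

Definition arithmetical : Prop := forall X : C, distributive_eqrels X.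

Record InternalGroupoid := MkGpd {
  g0 : C;  g1 : C;
  gd : Hom g1 g0;  gc : Hom g1 g0;  ge : Hom g0 g1;
  gd_e : gd \o ge = idm g0;
  gc_e : gc \o ge = idm g0;
  gP : C;  gp1 : Hom gP g1;  gp2 : Hom gP g1;
  gP_pb : is_pullback gc gd gp1 gp2;
  gm : Hom gP g1;
  gi : Hom g1 g1;
  gd_m : gd \o gm = gd \o gp1;
  gc_m : gc \o gm = gc \o gp2;
  gm_assoc : forall (T : C) (f g h : Hom T g1) (u v w x : Hom T gP),
      gp1 \o u = f -> gp2 \o u = g -> gp1 \o v = g -> gp2 \o v = h ->
      gp1 \o w = gm \o u -> gp2 \o w = h ->
      gp1 \o x = f -> gp2 \o x = gm \o v ->
      gm \o w = gm \o x;
  gm_unit_l : forall (T : C) (f : Hom T g1) (u : Hom T gP),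
      gp1 \o u = ge \o (gd \o f) -> gp2 \o u = f -> gm \o u = f;
  gm_unit_r : forall (T : C) (f : Hom T g1) (u : Hom T gP),
      gp1 \o u = f -> gp2 \o u = ge \o (gc \o f) -> gm \o u = f;
  gd_i : gd \o gi = gc;
  gc_i : gc \o gi = gd;
  gm_inv_r : forall (T : C) (f : Hom T g1) (u : Hom T gP),
      gp1 \o u = f -> gp2 \o u = gi \o f -> gm \o u = ge \o (gd \o f);
  gm_inv_l : forall (T : C) (f : Hom T g1) (u : Hom T gP),
      gp1 \o u = gi \o f -> gp2 \o u = f -> gm \o u = ge \o (gc \o f)
}.

Definition groupoids_are_relations : Prop :=
  forall G : InternalGroupoid, jointly_monic (gd G) (gc G).

Definition abelian_object (A : C) : Prop :=
  exists (P : C) (p1 p2 : Hom P A) (u v : Hom A P) (phi : Hom P A),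
    is_product p1 p2 /\
    p1 \o u = idm A /\ is_zero_map (p2 \o u) /\
    is_zero_map (p1 \o v) /\ p2 \o v = idm A /\
    phi \o u = idm A /\ phi \o v = idm A.

Definition only_zero_abelian : Prop :=
  forall A : C, abelian_object A -> is_zero_obj A.

End Notions.

(* Main.v *)
From Stdlib Require Import IndefiniteDescription.
Require Import Defs.

Set Implicit Arguments.
Unset Strict Implicit.

(** The proof is carried out in the internal regular logic, with generalized elements
    [T -> X] and existence meant locally, i.e. after passing to a regular epimorphism.

    Protomodularity says that a subobject containing the kernel and the section of a
    split epimorphism is everything.  This makes every relation difunctional, so
    reflexive relations are equivalences and equivalence relations permute; it makes
    morphisms with zero kernel monic; and it makes every unital [A x A -> A] an abelian
    group, i.e. a groupoid over [0].  Conversely composition in a groupoid restricts to a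
    unital operation on the kernel of [(d, c)].

    On an abelian [A], the kernel pairs of the two projections and of the addition of
    [A x A] generate a non-distributive diamond.  Conversely, given [R], [S], [V], dividing
    out [(R /\ S) \/ (R /\ V)] reduces distributivity to: if [R] meets [S] and [V]
    trivially, then it meets [S \/ V], which is the composite of [S] and [V], trivially.
    There the zero class of the intersection with [R] carries a unital addition,
    obtained by completing two adjacent parallelograms. *)

(** * Predicates on generalized elements *)

Definition mono (C : Cat) (X Y : C) (m : Hom X Y) : Prop :=
  forall (T : C) (u v : Hom T X), m \o u = m \o v -> u = v.

(* [P] is the membership predicate of a subobject of [X]. *)
Definition subobject (C : Cat) (X : C) (P : forall T : C, Hom T X -> Prop) : Prop :=
  exists (A : C) (m : Hom A X),
    mono m /\ forall (T : C) (x : Hom T X), P T x <-> exists a, m \o a = x.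

Definition er_rel (C : Cat) (X : C) (R : EqRel X) (T : C) (x y : Hom T X) : Prop :=
  exists t : Hom T (er_ob R), er_d R \o t = x /\ er_c R \o t = y.

(* The Kripke-Joyal existential for the regular topology. *)
Definition locally (C : Cat) (T : C) (P : forall T' : C, Hom T' T -> Prop) : Prop :=
  exists (T' : C) (e : Hom T' T), regular_epi e /\ P T' e.

Section SemiAbelian.
Context (C : Cat) (HC : semi_abelian C).

(** * Zero maps, products and pullbacks *)

Lemma comp_whisker (W X Y Z : C) (f : Hom Y Z) (g : Hom X Y) (h : Hom X Z) (x : Hom W X) :
  f \o g = h -> f \o (g \o x) = h \o x.
Proof. intros <-. apply comp_assoc. Qed.

Lemma pointedness : pointed C.
Proof. apply HC. Qed.

Lemma pullbacks : has_pullbacks C.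
Proof. apply HC. Qed.

Lemma regular_epi_stable : regular_epis_pullback_stable C.
Proof. apply HC. Qed.

Lemma zero_map_exists (X Y : C) : exists f : Hom X Y, is_zero_map f.
Proof.
destruct pointedness as (Z & Hi & Ht).
destruct (Ht X) as (a & _), (Hi Y) as (b & _).
exists (b \o a), Z, a, b. repeat split; assumption.
Qed.

(** [is_zero_map] is an existential property; choosing one zero map for each pair of objects turns
    it into an equation usable for rewriting. *)
Definition zero (X Y : C) : Hom X Y :=
  proj1_sig (constructive_indefinite_description _ (zero_map_exists X Y)).

Lemma zero_map_unique (X Y : C) (f g : Hom X Y) :
  is_zero_map f -> is_zero_map g -> f = g.
Proof.
intros (Z & a & b & (Hi & Ht) & ->) (Z' & a' & b' & (Hi' & Ht') & ->).
destruct (Ht' Z) as (k & _).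
destruct (Hi Y) as (y & Hy), (Ht' X) as (x & Hx).
rewrite (Hy b), <- (Hy (b' \o k)), <- comp_assoc.
rewrite (Hx (k \o a)), (Hx a'). reflexivity.
Qed.

Lemma is_zero_map_zero (X Y : C) : is_zero_map (zero X Y).
Proof. apply (proj2_sig (constructive_indefinite_description _ (zero_map_exists X Y))). Qed.

Lemma is_zero_map_iff (X Y : C) (f : Hom X Y) : is_zero_map f <-> f = zero X Y.
Proof.
split.
- intros H. apply zero_map_unique; [exact H | apply is_zero_map_zero].
- intros ->. apply is_zero_map_zero.
Qed.

Lemma comp_zero_l (X Y Z : C) (f : Hom X Y) : zero Y Z \o f = zero X Z.
Proof.
apply is_zero_map_iff.
destruct (is_zero_map_zero Y Z) as (O & a & b & HO & ->).
exists O, (a \o f), b. split; [exact HO | symmetry; apply comp_assoc].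
Qed.

Lemma comp_zero_r (X Y Z : C) (f : Hom Y Z) : f \o zero X Y = zero X Z.
Proof.
apply is_zero_map_iff.
destruct (is_zero_map_zero X Y) as (O & a & b & HO & ->).
exists O, a, (f \o b). split; [exact HO | apply comp_assoc].
Qed.

Lemma zero_obj_of_id_zero (A : C) : idm A = zero A A -> is_zero_obj A.
Proof.
intros H. split; intros X; exists (zero _ _); intros g.
- rewrite <- (comp_id_r g), H. apply comp_zero_r.
- rewrite <- (comp_id_l g), H. apply comp_zero_l.
Qed.

Lemma zero_obj_hom (A : C) (HA : is_zero_obj A) (T : C) (a : Hom T A) : a = zero T A.
Proof.
destruct (proj2 HA T) as (f & Hf). rewrite (Hf a). symmetry. apply Hf.
Qed.

(** A product is a pullback over a zero object. The sigma type packs the vertex with its projections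
    so that all three are chosen at once. *)
Lemma product_exists (A B : C) :
  exists P : {P : C & (Hom P A * Hom P B)%type},
    is_product (fst (projT2 P)) (snd (projT2 P)).
Proof.
destruct pointedness as (Z & HZ).
destruct (pullbacks (zero A Z) (zero B Z)) as (P & p1 & p2 & _ & HP).
exists (existT _ P (p1, p2)). intros T a b. apply HP.
rewrite !comp_zero_l. reflexivity.
Qed.

Definition prod_sig (A B : C) := constructive_indefinite_description _ (product_exists A B).
Definition prd (A B : C) : C := projT1 (proj1_sig (prod_sig A B)).
Definition pr1 (A B : C) : Hom (prd A B) A := fst (projT2 (proj1_sig (prod_sig A B))).
Definition pr2 (A B : C) : Hom (prd A B) B := snd (projT2 (proj1_sig (prod_sig A B))).
Arguments pr1 {A B}.
Arguments pr2 {A B}.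

Lemma prd_is_product (A B : C) : is_product (@pr1 A B) (@pr2 A B).
Proof. exact (proj2_sig (prod_sig A B)). Qed.

Lemma pairing_exists (A B P : C) (p1 : Hom P A) (p2 : Hom P B) (HP : is_product p1 p2)
    (T : C) (a : Hom T A) (b : Hom T B) :
  exists h : Hom T P, p1 \o h = a /\ p2 \o h = b.
Proof. destruct (HP T a b) as (h & H1 & H2 & _). exists h. split; assumption. Qed.

Definition pair (A B T : C) (a : Hom T A) (b : Hom T B) : Hom T (prd A B) :=
  proj1_sig (constructive_indefinite_description _
    (pairing_exists (@prd_is_product A B) a b)).

Lemma pr1_pair (A B T : C) (a : Hom T A) (b : Hom T B) : pr1 \o pair a b = a.
Proof. unfold pair. destruct (constructive_indefinite_description _ _) as [h H]. apply H. Qed.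

Lemma pr2_pair (A B T : C) (a : Hom T A) (b : Hom T B) : pr2 \o pair a b = b.
Proof. unfold pair. destruct (constructive_indefinite_description _ _) as [h H]. apply H. Qed.

Lemma product_ext (A B P : C) (p1 : Hom P A) (p2 : Hom P B) (HP : is_product p1 p2)
    (T : C) (f g : Hom T P) :
  p1 \o f = p1 \o g -> p2 \o f = p2 \o g -> f = g.
Proof.
intros H1 H2.
destruct (HP T (p1 \o g) (p2 \o g)) as (h & _ & _ & H).
rewrite (H f), (H g); auto.
Qed.

Lemma pair_ext (A B T : C) (f g : Hom T (prd A B)) :
  pr1 \o f = pr1 \o g -> pr2 \o f = pr2 \o g -> f = g.
Proof. apply product_ext, prd_is_product. Qed.

Lemma pair_comp (A B S T : C) (a : Hom T A) (b : Hom T B) (f : Hom S T) :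
  pair a b \o f = pair (a \o f) (b \o f).
Proof.
apply pair_ext.
- rewrite (comp_whisker _ (pr1_pair a b)), pr1_pair. reflexivity.
- rewrite (comp_whisker _ (pr2_pair a b)), pr2_pair. reflexivity.
Qed.

Lemma pair_eta (A B T : C) (f : Hom T (prd A B)) : pair (pr1 \o f) (pr2 \o f) = f.
Proof. apply pair_ext; [apply pr1_pair | apply pr2_pair]. Qed.

Lemma pair_zero_iff (A B T : C) (a : Hom T A) (b : Hom T B) :
  pair a b = zero T (prd A B) <-> a = zero T A /\ b = zero T B.
Proof.
split.
- intros H. split.
  + rewrite <- (pr1_pair a b), H. apply comp_zero_r.
  + rewrite <- (pr2_pair a b), H. apply comp_zero_r.
- intros [-> ->]. apply pair_ext; rewrite ?pr1_pair, ?pr2_pair, comp_zero_r; reflexivity.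
Qed.

Lemma pullback_ext (X Y Z P : C) (f : Hom X Z) (g : Hom Y Z) (p1 : Hom P X) (p2 : Hom P Y)
    (HP : is_pullback f g p1 p2) (T : C) (u v : Hom T P) :
  p1 \o u = p1 \o v -> p2 \o u = p2 \o v -> u = v.
Proof.
intros H1 H2. destruct HP as [Hc HP].
destruct (HP T (p1 \o v) (p2 \o v)) as (h & _ & _ & H).
- rewrite !comp_assoc, Hc. reflexivity.
- rewrite (H u), (H v); auto.
Qed.

Lemma pullback_lift (X Y Z P : C) (f : Hom X Z) (g : Hom Y Z) (p1 : Hom P X) (p2 : Hom P Y)
    (HP : is_pullback f g p1 p2) (T : C) (a : Hom T X) (b : Hom T Y) :
  f \o a = g \o b -> exists h, p1 \o h = a /\ p2 \o h = b.
Proof.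
intros H. destruct (proj2 HP T a b H) as (h & H1 & H2 & _). exists h. split; assumption.
Qed.

(** * Regular epimorphisms as covers *)

Lemma regular_epi_epi (X Q : C) (q : Hom X Q) (HQ : regular_epi q)
    (Y : C) (u v : Hom Q Y) : u \o q = v \o q -> u = v.
Proof.
destruct HQ as (R & f & g & Hc & HQ). intros H.
destruct (HQ Y (v \o q)) as (h & _ & Hu).
- rewrite <- !comp_assoc, Hc. reflexivity.
- rewrite (Hu u), (Hu v); auto.
Qed.

Lemma regular_epi_id (X : C) : regular_epi (idm X).
Proof.
exists X, (idm X), (idm X). split; [reflexivity |].
intros T a _. exists a. split; [apply comp_id_r |].
intros h Hh. rewrite <- Hh. symmetry. apply comp_id_r.
Qed.

(** The cover is the pullback of [q] along [u]. *)
Lemma regular_epi_lift (X Q T : C) (q : Hom X Q) (Hq : regular_epi q) (u : Hom T Q) :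
  locally (fun T' (e : Hom T' T) => exists w : Hom T' X, q \o w = u \o e).
Proof.
destruct (pullbacks q u) as (P & p1 & p2 & HP).
exists P, p2. split.
- exact (regular_epi_stable Hq HP).
- exists p1. apply HP.
Qed.

(** * Closure properties of subobjects: the regular logic *)

Lemma subobject_ext (X : C) (P Q : forall T : C, Hom T X -> Prop) :
  (forall T x, P T x <-> Q T x) -> subobject P -> subobject Q.
Proof.
intros H (A & m & Hm & HA). exists A, m. split; [exact Hm |].
intros T x. rewrite <- H. apply HA.
Qed.

Lemma subobject_stable (X : C) (P : forall T : C, Hom T X -> Prop) :
  subobject P -> forall (S T : C) (x : Hom T X) (f : Hom S T), P T x -> P S (x \o f).
Proof.
intros (A & m & Hm & HA) S T x f Hx.
apply HA in Hx. destruct Hx as [a <-].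
apply HA. exists (a \o f). apply comp_assoc.
Qed.

(** Descent: the cover [e] coequalizes some pair; the factorization of [x \o e] through the
    monomorphism [m] equalizes that pair too, hence factors through [e]. *)
Lemma subobject_local (X : C) (P : forall T : C, Hom T X -> Prop) :
  subobject P -> forall (T : C) (x : Hom T X),
    locally (fun T' e => P T' (x \o e)) -> P T x.
Proof.
intros (A & m & Hm & HA) T x (T' & e & He & Hx).
apply HA in Hx. destruct Hx as [a Ha]. apply HA.
pose proof (regular_epi_epi He) as Hepi.
destruct He as (R & f & g & Hc & HQ).
destruct (HQ A a) as (h & Hh & _).
- apply Hm. rewrite !comp_assoc, Ha, <- !comp_assoc, Hc. reflexivity.
- exists h. apply Hepi. rewrite <- comp_assoc, Hh. exact Ha.
Qed.

Lemma subobject_pull (X Y : C) (f : Hom Y X) (P : forall T : C, Hom T X -> Prop) :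
  subobject P -> subobject (fun T (y : Hom T Y) => P T (f \o y)).
Proof.
intros (A & m & Hm & HA).
destruct (pullbacks m f) as (Q & q1 & q2 & HQ).
exists Q, q2. split.
- intros T u v H. apply (pullback_ext HQ); [| exact H].
  apply Hm. rewrite !comp_assoc, (proj1 HQ), <- !comp_assoc, H. reflexivity.
- intros T y. rewrite HA. split.
  + intros [a Ha]. destruct (pullback_lift HQ Ha) as (h & _ & Hh). exists h. exact Hh.
  + intros [h <-]. exists (q1 \o h). rewrite !comp_assoc, (proj1 HQ). reflexivity.
Qed.

Lemma subobject_and (X : C) (P Q : forall T : C, Hom T X -> Prop) :
  subobject P -> subobject Q -> subobject (fun T x => P T x /\ Q T x).
Proof.
intros (A & m & Hm & HA) HQ.
destruct (subobject_pull m HQ) as (B & n & Hn & HB).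
exists B, (m \o n). split.
- intros T u v H. apply Hn, Hm. rewrite !comp_assoc. exact H.
- intros T x. rewrite HA. split.
  + intros [[a <-] H]. apply HB in H. destruct H as [b <-].
    exists b. symmetry. apply comp_assoc.
  + intros [b <-]. split.
    * exists (n \o b). apply comp_assoc.
    * rewrite <- comp_assoc. apply HB. exists b. reflexivity.
Qed.

(** The equalizer is the pullback of the diagonal of [Y] along [pair f g]. *)
Lemma subobject_eq (X Y : C) (f g : Hom X Y) :
  subobject (fun T (x : Hom T X) => f \o x = g \o x).
Proof.
assert (H : subobject (fun T (p : Hom T (prd Y Y)) => pr1 \o p = pr2 \o p)).
{ exists Y, (pair (idm Y) (idm Y)). split.
  - intros T u v H. rewrite !pair_comp, !comp_id_l in H.
    rewrite <- (pr1_pair u u), H. apply pr1_pair.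
  - intros T p. split.
    + intros H. exists (pr1 \o p). rewrite pair_comp, !comp_id_l.
      rewrite H at 2. apply pair_eta.
    + intros [y <-]. rewrite pair_comp, pr1_pair, pr2_pair. reflexivity. }
apply (subobject_pull (pair f g)) in H. revert H. apply subobject_ext.
intros T x. rewrite pair_comp, pr1_pair, pr2_pair. tauto.
Qed.

(** The image is the coequalizer [q] of the kernel pair of [f]. The induced [m] is monic: elements
    with equal values under [m] lift locally to [X], where they form an element of the kernel pair,
    which [q] collapses. *)
Lemma subobject_image (X Y : C) (f : Hom X Y) :
  subobject (fun T (y : Hom T Y) =>
    locally (fun T' (e : Hom T' T) => exists x, f \o x = y \o e)).
Proof.
destruct (pullbacks f f) as (P & p1 & p2 & HP).
destruct (proj1 (proj2 (proj1 (proj1 (proj2 HC)))) _ _ _ _ _ _ HP) as (I & q & Hq).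
assert (Hreg : regular_epi q) by (exists P, p1, p2; exact Hq).
destruct (proj2 Hq Y f (proj1 HP)) as (m & Hm & _).
assert (Hmono : mono m).
{ intros T u v H.
  destruct (regular_epi_lift Hreg u) as (T1 & e1 & He1 & w1 & Hw1).
  destruct (regular_epi_lift Hreg (v \o e1)) as (T2 & e2 & He2 & w2 & Hw2).
  apply (regular_epi_epi He1), (regular_epi_epi He2).
  assert (Hf : f \o (w1 \o e2) = f \o w2).
  { rewrite <- Hm, <- !comp_assoc, Hw2, (comp_whisker _ Hw1), !comp_assoc, H.
    reflexivity. }
  destruct (pullback_lift HP Hf) as (t & H1 & H2).
  rewrite <- Hw2, <- Hw1, <- comp_assoc, <- H1, <- H2, !comp_assoc, (proj1 Hq).
  reflexivity. }
exists I, m. split; [exact Hmono |].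
intros T y. split.
- intros (T' & e & He & x & Hx).
  destruct (@subobject_local Y (fun T y => exists a, m \o a = y)) with (x := y) as [a Ha].
  + exists I, m. split; [exact Hmono | reflexivity].
  + exists T', e. split; [exact He |]. exists (q \o x). rewrite comp_assoc, Hm. exact Hx.
  + exists a. exact Ha.
- intros [a <-]. destruct (regular_epi_lift Hreg a) as (T' & e & He & x & Hx).
  exists T', e. split; [exact He |]. exists x.
  rewrite <- Hm, <- !comp_assoc, Hx. reflexivity.
Qed.

(** Existential quantification is the image under the first projection. *)
Lemma subobject_ex (X Y : C) (P : forall T : C, Hom T (prd X Y) -> Prop) :
  subobject P -> subobject (fun T (x : Hom T X) =>
    locally (fun T' (e : Hom T' T) => exists y, P T' (pair (x \o e) y))).
Proof.
intros (A & m & Hm & HA).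
generalize (subobject_image (pr1 \o m)). apply subobject_ext.
intros T x. split; intros (T' & e & He & a & Ha); exists T', e; (split; [exact He |]).
- exists (pr2 \o m \o a). apply HA. exists a.
  rewrite <- Ha, <- !comp_assoc, pair_eta. reflexivity.
- apply HA in Ha. destruct Ha as [b Hb]. exists b.
  rewrite <- comp_assoc, Hb. apply pr1_pair.
Qed.

Lemma eq_local (T X : C) (x y : Hom T X) :
  locally (fun T' (e : Hom T' T) => x \o e = y \o e) -> x = y.
Proof. intros (T' & e & He & H). exact (regular_epi_epi He H). Qed.

(** * Protomodularity and its Mal'tsev consequences *)

(** The inclusion [m] of the subobject is a map of split epimorphisms over the identity of [B]. Both
    have kernel [K], so the split short five lemma makes [m] invertible. *)
Lemma split_epi_ind (A B : C) (p : Hom A B) (s : Hom B A) (P : forall T : C, Hom T A -> Prop) :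
  p \o s = idm B -> subobject P ->
  (forall (T : C) (a : Hom T A), p \o a = zero T B -> P T a) -> P B s ->
  forall (T : C) (a : Hom T A), P T a.
Proof.
intros Hps HP Hker Hs.
destruct HP as (A' & m & Hm & HA).
destruct pointedness as (Z & HZ).
destruct (pullbacks p (zero Z B)) as (K & k & z & HK).
assert (Hk : is_kernel k p).
{ split.
  - apply is_zero_map_iff. rewrite (proj1 HK). apply comp_zero_l.
  - intros T a Ha. apply is_zero_map_iff in Ha.
    destruct (@pullback_lift _ _ _ _ _ _ _ _ HK T a (zero T Z)) as (b & Hb & _).
    + rewrite Ha, comp_zero_r. reflexivity.
    + exists b. split; [exact Hb |]. intros b' Hb'.
      apply (pullback_ext HK); [congruence |].
      rewrite (zero_obj_hom HZ (z \o b)). apply (zero_obj_hom HZ). }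
apply HA in Hs. destruct Hs as [s' Hs'].
assert (Hk' : exists k', m \o k' = k).
{ apply HA, Hker, is_zero_map_iff, Hk. }
destruct Hk' as [k' Hk'].
assert (Hiso : is_iso m).
{ apply (proj1 (proj2 (proj2 HC)) A' B A B K K (p \o m) s' p s k' k m (idm B) (idm K)).
  - rewrite <- comp_assoc, Hs'. exact Hps.
  - exact Hps.
  - split.
    + rewrite <- comp_assoc, Hk'. apply Hk.
    + intros T a Ha. rewrite <- comp_assoc in Ha.
      destruct (proj2 Hk T (m \o a) Ha) as (b & Hb & Hu). exists b. split.
      * apply Hm. rewrite comp_assoc, Hk'. exact Hb.
      * intros b' Hb'. apply Hu. rewrite <- Hk', <- comp_assoc, Hb'. reflexivity.
  - exact Hk.
  - symmetry. apply comp_id_l.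
  - rewrite comp_id_r. exact Hs'.
  - rewrite comp_id_r. exact Hk'.
  - exists (idm B). split; apply comp_id_l.
  - exists (idm K). split; apply comp_id_l. }
destruct Hiso as (n & _ & Hn). intros T a. apply HA. exists (n \o a).
rewrite comp_assoc, Hn. apply comp_id_l.
Qed.

Lemma split_epi_ext (A B Y : C) (p : Hom A B) (s : Hom B A) (f g : Hom A Y) :
  p \o s = idm B -> f \o s = g \o s ->
  (forall (T : C) (a : Hom T A), p \o a = zero T B -> f \o a = g \o a) -> f = g.
Proof.
intros Hps Hs Hk.
rewrite <- (comp_id_r f), <- (comp_id_r g).
exact (split_epi_ind Hps (subobject_eq f g) Hk Hs (idm A)).
Qed.

(** The first projection of the kernel pair is split by the diagonal. Both projections agree on the
    diagonal and, by assumption, vanish on the kernel of the first, so they coincide. *)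
Lemma mono_of_trivial_kernel (A B : C) (f : Hom A B) :
  (forall (T : C) (a : Hom T A), f \o a = zero T B -> a = zero T A) -> mono f.
Proof.
intros Hf.
destruct (pullbacks f f) as (E & p1 & p2 & HE).
destruct (@pullback_lift _ _ _ _ _ _ _ _ HE A (idm A) (idm A) eq_refl) as (s & H1 & H2).
assert (H : p1 = p2).
{ apply (split_epi_ext H1).
  - congruence.
  - intros T a Ha. rewrite Ha. symmetry. apply Hf.
    rewrite comp_assoc, <- (proj1 HE), <- comp_assoc, Ha. apply comp_zero_r. }
intros T u v Huv. destruct (pullback_lift HE Huv) as (t & <- & <-). congruence.
Qed.

Lemma jointly_monic_pair (R X Y : C) (d : Hom R X) (c : Hom R Y) :
  mono (pair d c) <-> jointly_monic d c.
Proof.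
split.
- intros Hm T u v H1 H2. apply Hm. rewrite !pair_comp, H1, H2. reflexivity.
- intros Hm T u v H. rewrite !pair_comp in H. apply Hm.
  + rewrite <- (pr1_pair (d \o u) (c \o u)), H. apply pr1_pair.
  + rewrite <- (pr2_pair (d \o u) (c \o u)), H. apply pr2_pair.
Qed.


(** [D] is the object of chains [(u, v, w)], and forgetting [w] is a map to [E] split by repeating
    [v]. Hence only chains with [u = v = 0] and chains with [w = v] need to be treated. *)
Lemma difunctional (R X Y : C) (d : Hom R X) (c : Hom R Y) :
  jointly_monic d c ->
  forall (T : C) (u v w : Hom T R), c \o u = c \o v -> d \o v = d \o w ->
    exists t : Hom T R, d \o t = d \o u /\ c \o t = c \o w.
Proof.
intros Hm T u v w Huv Hvw.
destruct (pullbacks c c) as (E & e1 & e2 & HE).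
destruct (pullbacks (d \o e2) d) as (D & p & r & HD).
destruct (@pullback_lift _ _ _ _ _ _ _ _ HD E (idm E) e2 (comp_id_r _)) as (s & Hs1 & Hs2).
assert (Hsub : subobject (fun T (a : Hom T D) =>
    exists t : Hom T R, d \o t = d \o e1 \o p \o a /\ c \o t = c \o r \o a)).
{ assert (H : subobject (fun T (q : Hom T (prd X Y)) =>
      exists t : Hom T R, d \o t = pr1 \o q /\ c \o t = pr2 \o q)).
  { exists R, (pair d c). split.
    - apply jointly_monic_pair. exact Hm.
  - intros S q. split; intros [t Ht]; exists t.
      + rewrite pair_comp, (proj1 Ht), (proj2 Ht). apply pair_eta.
      + rewrite <- Ht, pair_comp, pr1_pair, pr2_pair. split; reflexivity. }
  apply (subobject_pull (pair (d \o e1 \o p) (c \o r))) in H.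
  revert H. apply subobject_ext. intros S a.
  rewrite pair_comp, pr1_pair, pr2_pair. reflexivity. }
destruct (pullback_lift HE Huv) as (uv & <- & <-).
destruct (@pullback_lift _ _ _ _ _ _ _ _ HD T uv w) as (a & <- & <-).
{ rewrite <- comp_assoc. exact Hvw. }
destruct (split_epi_ind Hs1 Hsub) with (a := a) as (t & H1 & H2).
(* When [u] and [v] vanish, [w] itself is the witness; when [w = v], it is [u]. *)
- intros S b Hb. exists (r \o b). split.
  + rewrite comp_assoc, <- (proj1 HD), <- !comp_assoc, Hb, !comp_zero_r. reflexivity.
  + apply comp_assoc.
- exists e1. rewrite <- !comp_assoc, Hs1, Hs2, comp_id_r. split; [reflexivity | apply HE].
- exists t. rewrite !comp_assoc. split; assumption.
Qed.

Lemma equiv_of_reflexive (R X : C) (d c : Hom R X) :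
  jointly_monic d c -> reflexive_rel d c -> is_equiv_rel d c.
Proof.
intros Hm Hr. split; [exact Hm |]. split; [exact Hr |].
destruct Hr as (e & Hd & Hc). split.
(* Symmetry: the chain [y R y], [x R y], [x R x] yields [y R x]. *)
- destruct (difunctional Hm (u := e \o c) (v := idm R) (w := e \o d)) as (s & H1 & H2).
  + rewrite comp_assoc, Hc, comp_id_l, comp_id_r. reflexivity.
  + rewrite comp_assoc, Hd, comp_id_l, comp_id_r. reflexivity.
  + exists s. rewrite H1, H2, !comp_assoc, Hd, Hc, !comp_id_l. split; reflexivity.
- intros T u v Huv.
  (* Transitivity: the chain [x R y], [y R y], [y R z] yields [x R z]. *)
  destruct (difunctional Hm (u := u) (v := e \o d \o v) (w := v)) as (s & H1 & H2).
  + rewrite !comp_assoc, Hc, comp_id_l. exact Huv.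
  + rewrite !comp_assoc, Hd, comp_id_l. reflexivity.
  + exists s. split; assumption.
Qed.

(** * Calculus of equivalence relations *)

Lemma subobject_rel (X : C) (R : EqRel X) (W : C) (f g : Hom W X) :
  subobject (fun T (w : Hom T W) => er_rel R (f \o w) (g \o w)).
Proof.
assert (H : subobject (fun T (p : Hom T (prd X X)) => er_rel R (pr1 \o p) (pr2 \o p))).
{ exists (er_ob R), (pair (er_d R) (er_c R)). split.
  - apply jointly_monic_pair, er_equiv.
  - intros T p. split; intros [t Ht]; exists t.
    + rewrite pair_comp, (proj1 Ht), (proj2 Ht). apply pair_eta.
    + rewrite <- Ht, pair_comp, pr1_pair, pr2_pair. split; reflexivity. }
apply (subobject_pull (pair f g)) in H. revert H. apply subobject_ext.
intros T w. rewrite pair_comp, pr1_pair, pr2_pair. reflexivity.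
Qed.

Lemma rel_refl (X : C) (R : EqRel X) (T : C) (x : Hom T X) : er_rel R x x.
Proof.
destruct (er_equiv R) as (_ & (e & H1 & H2) & _).
exists (e \o x). rewrite !comp_assoc, H1, H2, comp_id_l. split; reflexivity.
Qed.

Lemma rel_sym (X : C) (R : EqRel X) (T : C) (x y : Hom T X) : er_rel R x y -> er_rel R y x.
Proof.
intros (t & <- & <-). destruct (er_equiv R) as (_ & _ & (s & H1 & H2) & _).
exists (s \o t). rewrite !comp_assoc, H1, H2. split; reflexivity.
Qed.

Lemma rel_trans (X : C) (R : EqRel X) (T : C) (x y z : Hom T X) : er_rel R x y -> er_rel R y z -> er_rel R x z.
Proof.
intros (t & <- & <-) (u & Hu & <-). destruct (er_equiv R) as (_ & _ & _ & H).
destruct (H T t u (eq_sym Hu)) as (w & Hw). exists w. exact Hw.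
Qed.

Lemma rel_stable (X : C) (R : EqRel X) (S T : C) (x y : Hom T X) (f : Hom S T) :
  er_rel R x y -> er_rel R (x \o f) (y \o f).
Proof. intros (t & <- & <-). exists (t \o f). rewrite !comp_assoc. split; reflexivity. Qed.

Lemma rel_local (X : C) (R : EqRel X) (T : C) (x y : Hom T X) :
  locally (fun T' e => er_rel R (x \o e) (y \o e)) -> er_rel R x y.
Proof.
intros (T' & e & He & H).
pose proof (subobject_local (subobject_rel R x y) (x := idm T)) as L.
cbv beta in L. rewrite !comp_id_r in L. apply L.
exists T', e. split; [exact He |]. rewrite comp_id_l. exact H.
Qed.

Lemma er_le_iff (X : C) (R S : EqRel X) :
  er_le R S <-> forall (T : C) (x y : Hom T X), er_rel R x y -> er_rel S x y.
Proof.
split.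
- intros (m & H1 & H2) T x y (t & <- & <-).
  exists (m \o t). rewrite !comp_assoc, H1, H2. split; reflexivity.
- intros H. apply H. exists (idm _). rewrite !comp_id_r. split; reflexivity.
Qed.

(** Reflexivity at the generic element is the only axiom to check: [equiv_of_reflexive] supplies
    symmetry and transitivity. *)
Lemma eqrel_comprehension (X : C) (r : forall T : C, Hom T X -> Hom T X -> Prop) :
  subobject (fun T (p : Hom T (prd X X)) => r T (pr1 \o p) (pr2 \o p)) ->
  r X (idm X) (idm X) ->
  exists E : EqRel X, forall (T : C) (x y : Hom T X), er_rel E x y <-> r T x y.
Proof.
intros (A & m & Hm & HA) Hr.
assert (Hr' : forall (T : C) (x y : Hom T X), r T x y <-> exists a, m \o a = pair x y).
{ intros T x y. rewrite <- HA, pr1_pair, pr2_pair. reflexivity. }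
assert (HE : is_equiv_rel (pr1 \o m) (pr2 \o m)).
{ apply equiv_of_reflexive.
  - apply jointly_monic_pair. rewrite pair_eta. exact Hm.
  - apply Hr' in Hr. destruct Hr as [e He]. exists e.
    rewrite <- !comp_assoc, He, pr1_pair, pr2_pair. split; reflexivity. }
exists (MkEqRel HE). intros T x y. rewrite Hr'. split; intros [a Ha]; exists a.
- destruct Ha as [<- <-]. cbn. rewrite <- !comp_assoc. symmetry. apply pair_eta.
- cbn. rewrite <- !comp_assoc, Ha, pr1_pair, pr2_pair. split; reflexivity.
Qed.

Lemma eqrel_kernel_pair (X Y : C) (f : Hom X Y) :
  exists E : EqRel X, forall (T : C) (x y : Hom T X), er_rel E x y <-> f \o x = f \o y.
Proof.
apply (eqrel_comprehension (r := fun T x y => f \o x = f \o y)); [| reflexivity].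
generalize (subobject_eq (f \o pr1) (f \o pr2 (A := X) (B := X))).
apply subobject_ext. intros T p. rewrite !comp_assoc. reflexivity.
Qed.

Lemma eqrel_meet (X : C) (R S : EqRel X) :
  exists E : EqRel X, forall (T : C) (x y : Hom T X),
    er_rel E x y <-> er_rel R x y /\ er_rel S x y.
Proof.
apply (eqrel_comprehension (r := fun T x y => er_rel R x y /\ er_rel S x y)).
- exact (subobject_and (subobject_rel R pr1 pr2) (subobject_rel S pr1 pr2)).
- split; apply rel_refl.
Qed.

(** The order-theoretic meet is compared with the one built by conjunction, where elements can be
    computed. *)
Lemma is_meet_rel (X : C) (M R S : EqRel X) : is_meet M R S ->
  forall (T : C) (x y : Hom T X), er_rel M x y <-> er_rel R x y /\ er_rel S x y.
Proof.
intros (HR & HS & HM) T x y.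
destruct (eqrel_meet R S) as (E & HE).
rewrite er_le_iff in HR, HS. split; [auto |].
rewrite <- HE. revert T x y. apply er_le_iff, HM; apply er_le_iff; intros T x y H;
  apply HE in H; apply H.
Qed.

(* Composites of equivalence relations are again equivalence relations,
   because every reflexive relation is one. *)
Lemma eqrel_composite (X : C) (R S : EqRel X) :
  exists E : EqRel X, forall (T : C) (x z : Hom T X),
    er_rel E x z <->
    locally (fun T' e => exists y : Hom T' X, er_rel R (x \o e) y /\ er_rel S y (z \o e)).
Proof.
apply (eqrel_comprehension (r := fun T x z =>
  locally (fun T' e => exists y : Hom T' X, er_rel R (x \o e) y /\ er_rel S y (z \o e)))).
- generalize (subobject_ex (subobject_and
    (subobject_rel R (pr1 \o pr1) (pr2 (A := prd X X) (B := X)))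
    (subobject_rel S pr2 (pr2 \o pr1)))).
  apply subobject_ext. intros T p.
  split; intros (T' & e & He & y & H); exists T', e; (split; [exact He |]); exists y; revert H;
    rewrite <- !comp_assoc, pr1_pair, pr2_pair; auto.
- exists X, (idm X). split; [apply regular_epi_id |]. exists (idm X).
  rewrite comp_id_l. split; apply rel_refl.
Qed.

(** The composite of [S] followed by [R] is transitive and contains both relations, so it contains
    [R] followed by [S]. *)
Lemma rel_permute (X : C) (R S : EqRel X) (T : C) (x y z : Hom T X) :
  er_rel R x y -> er_rel S y z ->
  locally (fun T' e => exists b : Hom T' X, er_rel S (x \o e) b /\ er_rel R b (z \o e)).
Proof.
intros HR HS. destruct (eqrel_composite S R) as (E & HE). apply HE.
apply rel_trans with y; apply HE; exists T, (idm T); (split; [apply regular_epi_id |]);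
  rewrite !comp_id_r.
- exists x. split; [apply rel_refl | exact HR].
- exists z. split; [exact HS | apply rel_refl].
Qed.

(** The direct image along a cover stays reflexive, hence is an equivalence relation; [q] itself is
    the cover on which the generic element of [Q] lifts. *)
Lemma eqrel_image (X Q : C) (q : Hom X Q) (Hq : regular_epi q) (R : EqRel X) :
  exists E : EqRel Q, forall (T : C) (x y : Hom T Q),
    er_rel E x y <->
    locally (fun T' e => exists x' y' : Hom T' X,
      q \o x' = x \o e /\ q \o y' = y \o e /\ er_rel R x' y').
Proof.
apply (eqrel_comprehension (r := fun T x y => locally (fun T' e =>
  exists x' y' : Hom T' X, q \o x' = x \o e /\ q \o y' = y \o e /\ er_rel R x' y'))).
- generalize (subobject_image (pair (q \o er_d R) (q \o er_c R))).
  apply subobject_ext. intros T p.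
  split; intros (T' & e & He & H); exists T', e; (split; [exact He |]).
  + destruct H as (t & Ht). exists (er_d R \o t), (er_c R \o t).
    rewrite <- !comp_assoc, <- Ht, pair_comp, pr1_pair, pr2_pair, <- !comp_assoc.
    split; [reflexivity |]. split; [reflexivity |]. exists t. split; reflexivity.
  + destruct H as (x' & y' & Hx & Hy & t & <- & <-). exists t.
    rewrite pair_comp, <- !comp_assoc, Hx, Hy, <- !comp_assoc. apply pair_eta.
- exists X, q. split; [exact Hq |]. exists (idm X), (idm X).
  rewrite comp_id_l, comp_id_r. split; [reflexivity |]. split; [reflexivity | apply rel_refl].
Qed.

(** Since [G] is single-valued, its graph projects monically to [Y], so the existential is genuine
    rather than local. This is how a functional relation becomes a morphism. *)
Lemma subobject_functional (Y B : C) (G : forall T : C, Hom T Y -> Hom T B -> Prop) :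
  subobject (fun T (p : Hom T (prd Y B)) => G T (pr1 \o p) (pr2 \o p)) ->
  (forall (T : C) (y : Hom T Y) (b b' : Hom T B), G T y b -> G T y b' -> b = b') ->
  subobject (fun T (y : Hom T Y) => exists b, G T y b).
Proof.
intros (W & m & Hm & HW) HG.
exists W, (pr1 \o m). split.
- intros T u v H. rewrite <- !comp_assoc in H. apply Hm, pair_ext; [exact H |].
  apply (HG T (pr1 \o (m \o v))).
  + rewrite <- H. apply HW. exists u. reflexivity.
  + apply HW. exists v. reflexivity.
- intros T y. split.
  + intros [b Hb]. destruct (proj1 (HW T (pair y b))) as [a Ha].
    * rewrite pr1_pair, pr2_pair. exact Hb.
    * exists a. rewrite <- comp_assoc, Ha. apply pr1_pair.
  + intros [a <-]. exists (pr2 \o m \o a). rewrite <- !comp_assoc. apply HW.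
    exists a. reflexivity.
Qed.

(** * Abelian objects are internal abelian groups *)

Lemma abelian_object_iff (A : C) :
  abelian_object A <->
  exists phi : Hom (prd A A) A,
    phi \o pair (idm A) (zero A A) = idm A /\ phi \o pair (zero A A) (idm A) = idm A.
Proof.
split.
- intros (P & p1 & p2 & u & v & phi & HP & Hu1 & Hu2 & Hv1 & Hv2 & Hu & Hv).
  apply is_zero_map_iff in Hu2, Hv1.
  destruct (pairing_exists HP (@pr1 A A) pr2) as (h & H1 & H2).
  exists (phi \o h). rewrite <- !comp_assoc. split.
  + rewrite <- Hu at 2. f_equal. apply (product_ext HP).
    * rewrite comp_assoc, H1, Hu1. apply pr1_pair.
    * rewrite comp_assoc, H2, Hu2. apply pr2_pair.
  + rewrite <- Hv at 2. f_equal. apply (product_ext HP).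
    * rewrite comp_assoc, H1, Hv1. apply pr1_pair.
    * rewrite comp_assoc, H2, Hv2. apply pr2_pair.
- intros (phi & H1 & H2).
  exists (prd A A), pr1, pr2, (pair (idm A) (zero A A)), (pair (zero A A) (idm A)), phi.
  rewrite !is_zero_map_iff, !pr1_pair, !pr2_pair.
  repeat split; try assumption. apply prd_is_product.
Qed.

Section Magma.
Context (A : C) (phi : Hom (prd A A) A).
Hypotheses (phi_l : phi \o pair (idm A) (zero A A) = idm A)
  (phi_r : phi \o pair (zero A A) (idm A) = idm A).

Definition op (T : C) (a b : Hom T A) : Hom T A := phi \o pair a b.

Lemma op_comp (S T : C) (a b : Hom T A) (f : Hom S T) : op a b \o f = op (a \o f) (b \o f).
Proof. unfold op. rewrite <- comp_assoc, pair_comp. reflexivity. Qed.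

Lemma op_0_r (T : C) (a : Hom T A) : op a (zero T A) = a.
Proof.
rewrite <- (comp_id_l a) at 2. rewrite <- phi_l, <- comp_assoc, pair_comp, comp_id_l, comp_zero_l.
reflexivity.
Qed.

Lemma op_0_l (T : C) (a : Hom T A) : op (zero T A) a = a.
Proof.
rewrite <- (comp_id_l a) at 2. rewrite <- phi_r, <- comp_assoc, pair_comp, comp_id_l, comp_zero_l.
reflexivity.
Qed.

(** Both sides are maps on [prd A A]. On the section [(1, 0)] and on the kernel of [pr1] one
    argument is zero, so the unit laws decide. *)
Lemma op_comm (T : C) (a b : Hom T A) : op a b = op b a.
Proof.
assert (H : op (@pr1 A A) pr2 = op pr2 pr1).
{ apply (split_epi_ext (pr1_pair (idm A) (zero A A))).
  - rewrite !op_comp, pr1_pair, pr2_pair, op_0_r, op_0_l. reflexivity.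
  - intros S c Hc. rewrite !op_comp, Hc, op_0_r, op_0_l. reflexivity. }
apply (f_equal (fun g => g \o pair a b)) in H. cbv beta in H.
rewrite !op_comp, pr1_pair, pr2_pair in H. exact H.
Qed.

(** Same method, for the projection forgetting [z]: on its section [z = 0], on its kernel
    [x = y = 0]. *)
Lemma op_assoc (T : C) (a b c : Hom T A) : op (op a b) c = op a (op b c).
Proof.
pose (x := pr1 \o pr1 : Hom (prd (prd A A) A) A).
pose (y := pr2 \o pr1 : Hom (prd (prd A A) A) A).
pose (z := pr2 : Hom (prd (prd A A) A) A).
assert (H : op (op x y) z = op x (op y z)).
{ apply (split_epi_ext (pr1_pair (idm (prd A A)) (zero (prd A A) A)));
  unfold x, y, z.
  - rewrite !op_comp, <- !comp_assoc, pr1_pair, pr2_pair, !op_0_r. reflexivity.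
  - intros S d Hd.
    rewrite !op_comp, <- !comp_assoc, Hd, !comp_zero_r, !op_0_l. reflexivity. }
apply (f_equal (fun g => g \o pair (pair a b) c)) in H.
cbv beta delta [x y z] in H.
rewrite !op_comp, <- !comp_assoc, !pr1_pair, !pr2_pair in H. exact H.
Qed.

(* The shear map (a, b) |-> (a, a + b) has trivial kernel; its image contains the
   diagonal and the kernel of the first projection, so it is onto. *)
Lemma op_inverse : exists i : Hom A A, op (idm A) i = zero A A.
Proof.
assert (Hm : mono (pair (@pr1 A A) (op pr1 pr2))).
{ apply mono_of_trivial_kernel. intros T a Ha. rewrite pair_comp in Ha.
  apply pair_zero_iff in Ha. destruct Ha as [H1 H2].
  rewrite op_comp, H1, op_0_l in H2.
  apply pair_ext; rewrite comp_zero_r; assumption. }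
assert (Hs : subobject (fun T (x : Hom T (prd A A)) =>
    exists a, pair (@pr1 A A) (op pr1 pr2) \o a = x)).
{ eexists _, _. split; [exact Hm | reflexivity]. }
(* A preimage of [(1, 0)] under the shear map has the form [(1, i)] with [1 + i = 0]. *)
destruct (split_epi_ind (pr1_pair (idm A) (idm A)) Hs) with (a := pair (idm A) (zero A A))
  as [a Ha].
- intros T a Ha. exists a. apply pair_ext; rewrite pair_comp.
  + apply pr1_pair.
  + rewrite pr2_pair, op_comp, Ha. apply op_0_l.
- exists (pair (idm A) (zero A A)).
  rewrite pair_comp, op_comp, pr1_pair, pr2_pair, op_0_r. reflexivity.
- rewrite pair_comp, op_comp in Ha. exists (pr2 \o a).
  assert (H1 : pr1 \o a = idm A).
  { rewrite <- (pr1_pair (pr1 \o a) (op (pr1 \o a) (pr2 \o a))), Ha. apply pr1_pair. }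
  rewrite <- H1 at 1.
  rewrite <- (pr2_pair (pr1 \o a) (op (pr1 \o a) (pr2 \o a))), Ha. apply pr2_pair.
Qed.

(** Over a zero object all pairs of arrows are composable, so the addition serves as composition. *)
Lemma groupoid_of_magma : exists G : InternalGroupoid C, g1 G = A /\ is_zero_obj (g0 G).
Proof.
destruct pointedness as (Z & HZ). destruct op_inverse as [i Hi].
assert (Hop : forall (T : C) (u : Hom T (prd A A)), phi \o u = op (pr1 \o u) (pr2 \o u)).
{ intros T u. unfold op. rewrite pair_eta. reflexivity. }
assert (HiT : forall (T : C) (f : Hom T A), op f (i \o f) = zero T A).
{ intros T f. rewrite <- (comp_id_l f) at 1. rewrite <- op_comp, Hi. apply comp_zero_l. }
assert (Hpb : is_pullback (zero A Z) (zero A Z) (@pr1 A A) pr2).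
{ split; [rewrite !comp_zero_l; reflexivity |].
  intros T a b _. apply prd_is_product. }
unshelve refine (let G := @MkGpd C Z A (zero A Z) (zero A Z) (zero Z A) _ _
  (prd A A) pr1 pr2 Hpb phi i _ _ _ _ _ _ _ _ _ in
  ex_intro _ G (conj eq_refl HZ)).
- rewrite (zero_obj_hom HZ (idm Z)). apply comp_zero_l.
- rewrite (zero_obj_hom HZ (idm Z)). apply comp_zero_l.
- rewrite !comp_zero_l. reflexivity.
- rewrite !comp_zero_l. reflexivity.
- intros T f g h u v w x H1 H2 H3 H4 H5 H6 H7 H8.
  rewrite !Hop, H5, H6, H7, H8, !Hop, H1, H2, H3, H4. apply op_assoc.
- intros T f u H1 H2. rewrite Hop, H1, H2, comp_zero_l. apply op_0_l.
- intros T f u H1 H2. rewrite Hop, H1, H2, comp_zero_l. apply op_0_r.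
- apply comp_zero_l.
- apply comp_zero_l.
- intros T f u H1 H2. rewrite Hop, H1, H2, comp_zero_l. apply HiT.
- intros T f u H1 H2. rewrite Hop, H1, H2, comp_zero_l, op_comm. apply HiT.
Qed.

End Magma.

(** * Groupoids versus abelian objects *)

(** Domain and codomain land in a zero object, so joint monicity identifies the identity of [A] with
    the zero map. *)
Lemma only_zero_abelian_of_groupoids : groupoids_are_relations C -> only_zero_abelian C.
Proof.
intros HG A HA. apply abelian_object_iff in HA. destruct HA as (phi & H1 & H2).
destruct (groupoid_of_magma H1 H2) as (G & <- & HZ).
apply zero_obj_of_id_zero, (HG G); rewrite comp_zero_r; apply (zero_obj_hom HZ).
Qed.

Lemma groupoids_of_only_zero_abelian : only_zero_abelian C -> groupoids_are_relations C.
Proof.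
intros HA G. apply jointly_monic_pair, mono_of_trivial_kernel.
destruct (subobject_eq (pair (gd G) (gc G)) (zero _ _)) as (K & k & Hk & HK).
assert (Hker : forall T (a : Hom T (g1 G)),
  (gd G \o a = zero _ _ /\ gc G \o a = zero _ _) <-> exists b, k \o b = a).
{ intros T a. rewrite <- HK, comp_zero_l, pair_comp, pair_zero_iff. reflexivity. }
assert (Hk0 : gd G \o k = zero _ _ /\ gc G \o k = zero _ _).
{ apply Hker. exists (idm K). apply comp_id_r. }
destruct Hk0 as [Hd Hc].
(* Elements of [K] are loops at [0], hence composable, and their composite is again a loop at
   [0]. *)
destruct (@pullback_lift _ _ _ _ _ _ _ _ (gP_pb G) (prd K K) (k \o pr1) (k \o pr2))
  as (u & Hu1 & Hu2).
{ rewrite !comp_assoc, Hd, Hc, !comp_zero_l. reflexivity. }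
destruct (proj1 (Hker _ (gm G \o u))) as [phi Hphi].
{ rewrite !comp_assoc, gd_m, gc_m, <- !comp_assoc, Hu1, Hu2, !comp_assoc, Hd, Hc,
    !comp_zero_l. split; reflexivity. }
assert (HZ : is_zero_obj K).
{ apply HA, abelian_object_iff. exists phi.
  split; apply Hk; rewrite comp_assoc, Hphi, comp_id_r, <- comp_assoc.
  (* The identity arrow at [0] is the zero element of [K]. *)
  - apply gm_unit_r; rewrite comp_assoc, ?Hu1, ?Hu2, <- comp_assoc, ?pr1_pair, ?pr2_pair.
    + apply comp_id_r.
    + rewrite Hc, !comp_zero_r. reflexivity.
  - apply gm_unit_l; rewrite comp_assoc, ?Hu1, ?Hu2, <- comp_assoc, ?pr1_pair, ?pr2_pair.
    + rewrite Hd, !comp_zero_r. reflexivity.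
    + apply comp_id_r. }
intros T a Ha.
destruct (proj1 (HK T a)) as [b <-].
- rewrite Ha, comp_zero_l. reflexivity.
- rewrite (zero_obj_hom HZ b). apply comp_zero_r.
Qed.

(** * The non-distributive diamond on an abelian object *)

(** With [J] total and [D] discrete, [S] and [V] join to [J] but each meets [R] in [D];
    distributivity then forces [R] below [D]. *)
Lemma only_zero_abelian_of_arithmetical : arithmetical C -> only_zero_abelian C.
Proof.
intros Har A HA. apply abelian_object_iff in HA. destruct HA as (phi & Hl & Hr).
destruct (op_inverse Hl Hr) as [i Hi].
destruct (eqrel_kernel_pair (@pr1 A A)) as (R & HR).
destruct (eqrel_kernel_pair (@pr2 A A)) as (S & HS).
destruct (eqrel_kernel_pair phi) as (V & HV).
destruct (eqrel_kernel_pair (zero (prd A A) A)) as (J & HJ).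
destruct (eqrel_kernel_pair (idm (prd A A))) as (D & HD).
assert (Hphi : forall T (u : Hom T (prd A A)), phi \o u = op phi (pr1 \o u) (pr2 \o u)).
{ intros T u. unfold op. rewrite pair_eta. reflexivity. }
assert (Hi' : forall T (a : Hom T A), op phi (i \o a) a = zero T A).
{ intros T a. rewrite (op_comm Hl Hr). rewrite <- (comp_id_l a) at 1.
  rewrite <- op_comp, Hi. apply comp_zero_l. }
assert (HRJ : forall E, er_le E J).
{ intros E. apply er_le_iff. intros. apply HJ. rewrite !comp_zero_l. reflexivity. }
assert (HDE : forall E, er_le D E).
{ intros E. apply er_le_iff. intros T x y H. apply HD in H. rewrite !comp_id_l in H.
  subst y. apply rel_refl. }
assert (HSV : is_join J S V).
{ split; [apply HRJ |]. split; [apply HRJ |].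
  intros E HSE HVE. rewrite er_le_iff in *. intros T x y _.
  (* [c] solves [c + pr2 x = pr1 y + pr2 y], so [(c, pr2 x)] shares its second coordinate with [x]
     and its sum with [y]. *)
  pose (c := op phi (op phi (pr1 \o y) (pr2 \o y)) (i \o (pr2 \o x))).
  apply rel_trans with (pair c (pr2 \o x)).
  - apply HSE, HS. rewrite pr2_pair. reflexivity.
  - apply HVE, HV. rewrite !Hphi, pr1_pair, pr2_pair. unfold c.
    rewrite (op_assoc Hl Hr), Hi'. apply (op_0_r Hl). }
assert (HM : is_meet R R J).
{ split; [| split; [apply HRJ | auto]]. apply er_le_iff. auto. }
assert (HM1 : is_meet D R S).
{ split; [apply HDE |]. split; [apply HDE |].
  intros E HER HES. rewrite er_le_iff in *. intros T x y H. apply HD.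
  rewrite !comp_id_l. apply pair_ext; [apply HR, HER, H | apply HS, HES, H]. }
assert (HM2 : is_meet D R V).
{ split; [apply HDE |]. split; [apply HDE |].
  intros E HER HEV. rewrite er_le_iff in *. intros T x y H. apply HD.
  assert (H1 : pr1 \o x = pr1 \o y) by (apply HR, HER, H).
  assert (H2 : phi \o x = phi \o y) by (apply HV, HEV, H).
  rewrite !Hphi, H1 in H2.
  rewrite !comp_id_l. apply pair_ext; [exact H1 |].
  apply (f_equal (op phi (i \o (pr1 \o y)))) in H2.
  rewrite <- !(op_assoc Hl Hr), Hi', !(op_0_l Hr) in H2. exact H2. }
assert (HJ' : is_join D D D).
{ split; [apply HDE |]. split; [apply HDE | auto]. }
pose proof (Har (prd A A) R S V J R D D D HSV HM HM1 HM2 HJ') as H.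
rewrite er_le_iff in H.
assert (H0 : er_rel D (pair (zero A A) (idm A)) (pair (zero A A) (zero A A))).
{ apply H, HR. rewrite !pr1_pair. reflexivity. }
apply HD in H0. rewrite !comp_id_l in H0.
apply zero_obj_of_id_zero.
rewrite <- (pr2_pair (zero A A) (idm A)), H0. apply pr2_pair.
Qed.

(** * Addition by completing parallelograms *)

Section Parallelogram.
Context (X : C) (R S V : EqRel X).

(* [w] is the sum [x + z], for [R]-related [0], [x], [z]: walk from [0] to [z] along
   [S] and then [V], and transport both steps along [R] so that they start at [x].
<<
      0 --S-- a --V-- z
      |R      |R      |R
      x --S-- b --V-- w
>> *)
Definition parallel (T : C) (x z w : Hom T X) : Prop :=
  locally (fun T' e => exists p : Hom T' (prd X X),
    (er_rel S (zero T' X) (pr1 \o p) /\ er_rel V (pr1 \o p) (z \o e)) /\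
    (er_rel S (x \o e) (pr2 \o p) /\ er_rel R (pr2 \o p) (pr1 \o p)) /\
    (er_rel V (pr2 \o p) (w \o e) /\ er_rel R (w \o e) (z \o e))).

Lemma parallel_intro (T : C) (x z w a b : Hom T X) :
  er_rel S (zero T X) a -> er_rel V a z -> er_rel S x b -> er_rel R b a ->
  er_rel V b w -> er_rel R w z -> parallel x z w.
Proof.
intros. exists T, (idm T). split; [apply regular_epi_id |].
exists (pair a b). rewrite !comp_id_r, pr1_pair, pr2_pair. auto.
Qed.

(** The two vertices [a], [b] are packed into one product element and the six conditions bracketed
    in pairs, so that [subobject_ex] and [subobject_and] apply directly. *)
Lemma subobject_parallel (W : C) (f g h : Hom W X) :
  subobject (fun T (p : Hom T W) => parallel (f \o p) (g \o p) (h \o p)).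
Proof.
pose (P := @pr1 W (prd X X)).
pose (a := pr1 \o @pr2 W (prd X X)).
pose (b := pr2 \o @pr2 W (prd X X)).
generalize (subobject_ex
  (subobject_and (subobject_and (subobject_rel S (zero _ X) a) (subobject_rel V a (g \o P)))
  (subobject_and (subobject_and (subobject_rel S (f \o P) b) (subobject_rel R b a))
   (subobject_and (subobject_rel V b (h \o P)) (subobject_rel R (h \o P) (g \o P)))))).
apply subobject_ext. intros T p. unfold a, b, P.
split; intros (T' & e & He & q & H); exists T', e; (split; [exact He |]); exists q; revert H;
  rewrite <- !comp_assoc, pr1_pair, pr2_pair, comp_zero_l; auto.
Qed.

Lemma parallel_stable (T' T : C) (x z w : Hom T X) (e : Hom T' T) :
  parallel x z w -> parallel (x \o e) (z \o e) (w \o e).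
Proof.
intros H. pose proof (subobject_stable (subobject_parallel x z w) e (x := idm T)) as L.
cbv beta in L. rewrite !comp_id_r, !comp_id_l in L. exact (L H).
Qed.

Lemma parallel_local (T : C) (x z w : Hom T X) :
  locally (fun T' e => parallel (x \o e) (z \o e) (w \o e)) -> parallel x z w.
Proof.
intros (T' & e & He & H).
pose proof (subobject_local (subobject_parallel x z w) (x := idm T)) as L.
cbv beta in L. rewrite !comp_id_r in L. apply L.
exists T', e. split; [exact He |]. rewrite comp_id_l. exact H.
Qed.

Hypothesis HRS : forall (T : C) (x y : Hom T X), er_rel R x y -> er_rel S x y -> x = y.
Hypothesis HRV : forall (T : C) (x y : Hom T X), er_rel R x y -> er_rel V x y -> x = y.

(** Two choices [a], [a'] are related by both [S] and [V]. Transporting this along [R] relates [b]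
    and [b'] by [V], hence also [w] and [w']. *)
Lemma parallel_unique (T : C) (x z w w' : Hom T X) :
  parallel x z w -> parallel x z w' -> w = w'.
Proof.
destruct (eqrel_meet S V) as (E & HE).
intros (T1 & e1 & He1 & p & (Ha & Haz) & (Hxb & Hba) & (Hbw & Hwz)) H'.
apply eq_local. exists T1, e1. split; [exact He1 |].
apply (parallel_stable e1) in H'.
destruct H' as (T2 & e2 & He2 & p' & (Ha' & Haz') & (Hxb' & Hba') & (Hbw' & Hwz')).
apply eq_local. exists T2, e2. split; [exact He2 |].
apply (rel_stable e2) in Ha, Haz, Hxb, Hba, Hbw, Hwz.
rewrite comp_zero_l in Ha.
set (a := pr1 \o p \o e2) in *. set (b := pr2 \o p \o e2) in *.
set (a' := pr1 \o p') in *. set (b' := pr2 \o p') in *.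
assert (Haa : er_rel E a a').
{ apply HE. split.
  - apply rel_trans with (zero T2 X); [apply rel_sym; exact Ha | exact Ha'].
  - apply rel_trans with (z \o e1 \o e2); [exact Haz | apply rel_sym; exact Haz']. }
assert (Hbb : er_rel V b b').
{ apply rel_local.
  (* The new corner [c] equals [b']: they are [R]-related through [a'], and [S]-related through [b]
     and [x]. *)
  destruct (rel_permute Hba Haa) as (T3 & e3 & He3 & c & Hbc & Hca).
  exists T3, e3. split; [exact He3 |].
  apply (rel_stable e3) in Hxb, Hxb', Hba'.
  apply HE in Hbc. destruct Hbc as [HbcS HbcV].
  replace (b' \o e3) with c; [exact HbcV |].
  apply HRS.
  - apply rel_trans with (a' \o e3); [exact Hca | apply rel_sym; exact Hba'].
  - apply rel_trans with (b \o e3); [apply rel_sym; exact HbcS |].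
    apply rel_trans with (x \o e1 \o e2 \o e3); [apply rel_sym; exact Hxb | exact Hxb']. }
apply HRV.
- apply rel_trans with (z \o e1 \o e2); [exact Hwz | apply rel_sym; exact Hwz'].
- apply rel_trans with b; [apply rel_sym; exact Hbw |].
  apply rel_trans with b'; [exact Hbb | exact Hbw'].
Qed.

(** [A] is the zero class of [M], the meet of [R] with the composite of [S] and [V]. The relation
    [parallel] makes it an abelian object, so [A] is zero and [M] is discrete. *)
Lemma disjoint_composite :
  only_zero_abelian C ->
  forall (T : C) (x y z : Hom T X), er_rel R x z -> er_rel S x y -> er_rel V y z -> x = z.
Proof.
intros Hab.
destruct (eqrel_composite S V) as (U & HU).
destruct (eqrel_meet R U) as (M & HM).
assert (HSVU : forall T (x y z : Hom T X), er_rel S x y -> er_rel V y z -> er_rel U x z).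
{ intros T x y z H1 H2. apply HU. exists T, (idm T). split; [apply regular_epi_id |].
  exists y. rewrite !comp_id_r. split; assumption. }
destruct (subobject_rel M (zero X X) (idm X)) as (A & n & Hn & HA).
assert (HA' : forall T (x : Hom T X), er_rel M (zero T X) x <-> exists a, n \o a = x).
{ intros T x. rewrite <- HA, comp_zero_l, comp_id_l. reflexivity. }
assert (HnA : forall T (a : Hom T A), er_rel M (zero T X) (n \o a)).
{ intros T a. apply HA'. exists a. reflexivity. }
pose (G := fun T (y : Hom T (prd A A)) (w : Hom T A) =>
  parallel (n \o pr1 \o y) (n \o pr2 \o y) (n \o w)).
(* Sums exist at first only locally; their uniqueness lets them descend along covers. *)
assert (HGsub : subobject (fun T (y : Hom T (prd A A)) => exists w, G T y w)).
{ apply subobject_functional.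
  - generalize (subobject_parallel (n \o pr1 \o pr1) (n \o pr2 \o pr1)
      (n \o pr2 (A := prd A A) (B := A))).
    apply subobject_ext. intros T p. unfold G. rewrite <- !comp_assoc. reflexivity.
  - intros T y w w' H H'. apply Hn. exact (parallel_unique H H'). }
assert (HG : forall T (y : Hom T (prd A A)), exists w, G T y w).
{ intros T y.
  pose proof (HnA T (pr1 \o y)) as Hx. pose proof (HnA T (pr2 \o y)) as Hz.
  apply HM in Hx, Hz. destruct Hx as [HxR HxU], Hz as [HzR HzU].
  apply HU in HzU. destruct HzU as (T1 & e1 & He1 & a & Ha & Haz).
  apply (subobject_local HGsub). exists T1, e1. split; [exact He1 |].
  apply (rel_stable e1) in HxR, HxU, HzR.
  rewrite comp_zero_l in Ha, HxR, HxU, HzR.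
  (* Left square: [x R 0 S a] is completed by [b]. *)
  destruct (rel_permute (rel_sym HxR) Ha) as (T2 & e2 & He2 & b & Hxb & Hba).
  apply (subobject_local HGsub). exists T2, e2. split; [exact He2 |].
  apply (rel_stable e2) in HxR, HxU, HzR, Ha, Haz.
  rewrite comp_zero_l in Ha, HxR, HxU, HzR.
  (* Right square: [b R a V z] is completed by [w]. *)
  destruct (rel_permute Hba Haz) as (T3 & e3 & He3 & w & Hbw & Hwz).
  apply (subobject_local HGsub). exists T3, e3. split; [exact He3 |].
  apply (rel_stable e3) in HxR, HxU, HzR, Ha, Haz, Hxb, Hba.
  rewrite comp_zero_l in Ha, HxR, HxU, HzR.
  destruct (proj1 (HA' T3 w)) as [c Hc].
  - apply HM. split.
    + exact (rel_trans HzR (rel_sym Hwz)).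
    + exact (rel_trans HxU (HSVU _ _ _ _ Hxb Hbw)).
  - exists c. unfold G. rewrite Hc. rewrite <- !comp_assoc in *.
    exact (parallel_intro Ha Haz Hxb Hba Hbw Hwz). }
destruct (HG _ (idm (prd A A))) as [phi Hphi].
assert (Hphi' : forall T (x z : Hom T A), parallel (n \o x) (n \o z) (n \o (phi \o pair x z))).
{ intros T x z. apply (parallel_stable (pair x z)) in Hphi.
  rewrite !comp_id_r, <- !comp_assoc, pr1_pair, pr2_pair in Hphi. exact Hphi. }
assert (HZ : is_zero_obj A).
{ apply Hab, abelian_object_iff. exists phi.
  split; apply Hn; (eapply parallel_unique; [apply Hphi' |]);
    rewrite comp_id_r, comp_zero_r.
  - pose proof (HnA A (idm A)) as H. apply HM in H. rewrite comp_id_r in H.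
    (* For [x + 0] both squares have constant horizontal sides; for [0 + z] below, the vertical
       sides are constant. *)
    apply parallel_intro with (a := zero A X) (b := n); try apply rel_refl;
    apply rel_sym, H.
  - pose proof (HnA A (idm A)) as H. apply HM in H. rewrite comp_id_r in H.
    destruct H as [_ H]. apply HU in H. destruct H as (T & e & He & a & Ha & Haz).
    apply parallel_local. exists T, e. split; [exact He |].
    rewrite comp_zero_l. rewrite comp_zero_l in Ha.
    exact (parallel_intro Ha Haz Ha (rel_refl R a) Haz (rel_refl R _)). }
(* The legs of [M] agree on the diagonal, and on the kernel of [er_d M] because the zero class is
   trivial. *)
assert (Hdc : er_d M = er_c M).
{ destruct (er_equiv M) as (_ & (e & Hd & Hc) & _).
  apply (split_epi_ext Hd); [congruence |].
  intros T t Ht. rewrite Ht. symmetry.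
  destruct (proj1 (HA' T (er_c M \o t))) as [a <-].
  - exists t. split; [exact Ht | reflexivity].
  - rewrite (zero_obj_hom HZ a). apply comp_zero_r. }
intros T x y z HR HS HV.
assert (H : er_rel M x z) by (apply HM; split; [exact HR | exact (HSVU _ _ _ _ HS HV)]).
destruct H as (t & <- & <-). rewrite Hdc. reflexivity.
Qed.

End Parallelogram.

(** * Reduction of distributivity to the disjoint case *)

Lemma arithmetical_of_only_zero_abelian : only_zero_abelian C -> arithmetical C.
Proof.
intros Hab X R S V J M M1 M2 J' HJ HM HM1 HM2 HJ'.
(* Effectiveness makes [J'] the kernel pair of some [q0]; its coequalizer [q] is a regular
   epimorphism with the same kernel pair. *)
destruct (proj2 (proj1 (proj2 HC)) _ _ _ _ (er_equiv J')) as (Q0 & q0 & Hq0).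
destruct (proj1 (proj2 (proj1 (proj1 (proj2 HC)))) _ _ _ _ _ _ Hq0) as (Q & q & Hq).
assert (Hreg : regular_epi q) by (exists (er_ob J'), (er_d J'), (er_c J'); exact Hq).
assert (HqJ : forall T (x y : Hom T X), er_rel J' x y <-> q \o x = q \o y).
{ intros T x y. split.
  - intros (t & <- & <-). rewrite !comp_assoc, (proj1 Hq). reflexivity.
  - intros H. destruct (proj2 Hq Q0 q0 (proj1 Hq0)) as (h & Hh & _).
    apply (pullback_lift Hq0). rewrite <- Hh, <- !comp_assoc, H. reflexivity. }
pose proof (is_meet_rel HM) as HMr.
pose proof (is_meet_rel HM1) as HM1r. pose proof (is_meet_rel HM2) as HM2r.
assert (HJ'R : forall T (x y : Hom T X), er_rel J' x y -> er_rel R x y).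
{ apply er_le_iff, HJ'; [apply HM1 | apply HM2]. }
assert (HM1J : forall T (x y : Hom T X), er_rel M1 x y -> er_rel J' x y)
  by (apply er_le_iff, HJ').
assert (HM2J : forall T (x y : Hom T X), er_rel M2 x y -> er_rel J' x y)
  by (apply er_le_iff, HJ').
destruct (eqrel_image Hreg R) as (Rq & HRq).
destruct (eqrel_image Hreg S) as (Sq & HSq).
destruct (eqrel_image Hreg V) as (Vq & HVq).
(* The modular law in element form: J' <= R and R /\ E <= J' give R /\ (E \/ J') <= J'. *)
assert (Hdis : forall (E : EqRel X) (Eq : EqRel Q),
  (forall T (x y : Hom T Q), er_rel Eq x y <->
    locally (fun T' e => exists x' y' : Hom T' X,
      q \o x' = x \o e /\ q \o y' = y \o e /\ er_rel E x' y')) ->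
  (forall T (x y : Hom T X), er_rel R x y -> er_rel E x y -> er_rel J' x y) ->
  forall T (x y : Hom T Q), er_rel Rq x y -> er_rel Eq x y -> x = y).
{ intros E Eq HEq HRE T x y HxyR HxyE.
  apply HRq in HxyR. destruct HxyR as (T1 & e1 & He1 & x1 & y1 & Hx1 & Hy1 & H1).
  apply eq_local. exists T1, e1. split; [exact He1 |].
  apply (rel_stable e1), HEq in HxyE.
  destruct HxyE as (T2 & e2 & He2 & x2 & y2 & Hx2 & Hy2 & H2).
  apply eq_local. exists T2, e2. split; [exact He2 |].
  rewrite <- Hx2, <- Hy2. apply HqJ, HRE; [| exact H2].
  apply (rel_stable e2) in H1.
  apply rel_trans with (x1 \o e2).
  - apply HJ'R, HqJ. rewrite Hx2, comp_assoc, Hx1. reflexivity.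
  - apply rel_trans with (y1 \o e2); [exact H1 |].
    apply HJ'R, HqJ. rewrite Hy2, comp_assoc, Hy1. reflexivity. }
assert (Hlift : forall (E : EqRel X) (Eq : EqRel Q),
  (forall T (x y : Hom T Q), er_rel Eq x y <->
    locally (fun T' e => exists x' y' : Hom T' X,
      q \o x' = x \o e /\ q \o y' = y \o e /\ er_rel E x' y')) ->
  forall T (x y : Hom T X), er_rel E x y -> er_rel Eq (q \o x) (q \o y)).
{ intros E Eq HEq T x y H. apply HEq. exists T, (idm T). split; [apply regular_epi_id |].
  exists x, y. rewrite !comp_id_r. split; [reflexivity |]. split; [reflexivity | exact H]. }
destruct (eqrel_composite S V) as (U & HU).
(* The composite [U] is an upper bound of [S] and [V], so elements related by the join [J] are
   linked locally by one [S]-step and one [V]-step. *)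
assert (HJU : forall T (x y : Hom T X), er_rel J x y -> er_rel U x y).
{ apply er_le_iff, HJ; apply er_le_iff; intros T x y H; apply HU;
    exists T, (idm T); (split; [apply regular_epi_id |]); rewrite !comp_id_r.
  - exists y. split; [exact H | apply rel_refl].
  - exists x. split; [apply rel_refl | exact H]. }
apply er_le_iff. intros T x z H. apply HMr in H. destruct H as [HR HxJ].
apply HJU, HU in HxJ. destruct HxJ as (T' & e & He & y & HS & HV).
apply HqJ, eq_local. exists T', e. split; [exact He |].
apply (rel_stable e) in HR. rewrite <- !comp_assoc.
refine (@disjoint_composite Q Rq Sq Vq _ _ Hab T' (q \o (x \o e)) (q \o y) (q \o (z \o e)) _ _ _).
- apply (Hdis S Sq HSq). intros. apply HM1J, HM1r. split; assumption.
- apply (Hdis V Vq HVq). intros. apply HM2J, HM2r. split; assumption.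
- exact (Hlift R Rq HRq _ _ _ HR).
- exact (Hlift S Sq HSq _ _ _ HS).
- exact (Hlift V Vq HVq _ _ _ HV).
Qed.

End SemiAbelian.

Theorem mainTheorem20 (C : Cat) (HC : semi_abelian C) :
  (arithmetical C <-> groupoids_are_relations C) /\
  (groupoids_are_relations C <-> only_zero_abelian C).
Proof.
pose proof (@only_zero_abelian_of_groupoids C HC).
pose proof (@groupoids_of_only_zero_abelian C HC).
pose proof (@only_zero_abelian_of_arithmetical C HC).
pose proof (@arithmetical_of_only_zero_abelian C HC).
tauto.
Qed.
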